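(* Let $X$ be a countable regular crowded space such that at every point of $X$ the character is equal to the $\pi$-character. Then $X$ has far points.
   Context: All spaces are Tychonoff (in particular Hausdorff). A space is crowded if it is non-empty and has no isolated points. The character $\chi(x,X)$ of a point $x\in X$ is the minimal cardinality of a local base at $x$. A local $\pi$-base at $x$ is a family of non-empty open sets such that every neighborhood of $x$ contains a member of the family; the $\pi$-character $\pi\chi(x)$ of $x$ is the minimal cardinality of a local $\pi$-base at $x$. $\beta X$ is the Čech–Stone compactification of $X$. A far point of $X$ is a point $p\in\beta X\setminus X$ such that $p\notin\mathrm{cl}_{\beta X}(D)$ for every closed discrete subset $D$ of $X$. *)

(* Defs.v *)
From HB Require Import structures.
From mathcomp Require Import all_boot all_order all_algebra.
From mathcomp Require Import all_classical all_reals all_analysis.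

Set Implicit Arguments.
Unset Strict Implicit.
Unset Printing Implicit Defensive.
Import Order.TTheory GRing.Theory Num.Theory numFieldNormedType.Exports.
Local Open Scope classical_set_scope.
Local Open Scope ring_scope.
Local Open Scope card_scope.

Definition tychonoff_space (X : topologicalType) : Prop :=
  hausdorff_space X /\ completely_regular_space X.

Definition crowded_space (X : topologicalType) : Prop :=
  [set: X] !=set0 /\ isolated [set: X] = set0.

Definition discrete_subset (X : topologicalType) (D : set X) : Prop :=
  D `<=` isolated D.

Section Characters.
Variables (X : topologicalType) (x : X).

Definition local_base (B : set (set X)) : Prop :=
  B `<=` open_nbhs x /\
  forall V, nbhs x V -> exists2 U, B U & U `<=` V.

Definition local_pi_base (B : set (set X)) : Prop :=
  B `<=` [set U | open U /\ U !=set0] /\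
  forall V, nbhs x V -> exists2 U, B U & U `<=` V.

(* A cardinal is represented by a set having that cardinality: the least
   cardinality of the families satisfying [P] is that of any family [B] such
   that [least_card P B]. *)
Definition least_card (P : set (set (set X))) (B : set (set X)) : Prop :=
  P B /\ forall C, P C -> B #<= C.

Definition character_eq_pi_character : Prop :=
  exists B C, [/\ least_card local_base B, least_card local_pi_base C & B #= C].

End Characters.

Section StoneCech.
Variables (R : realType) (X : topologicalType).

Definition unit_map : Type :=
  {f : X -> R | continuous f /\ range f `<=` `[0, 1]}.

Definition unit_cube : topologicalType := {ptws unit_map -> R}.

Definition cube_eval (x : X) : unit_cube := fun f => sval f x.

(* The closure of the image of [X] in the cube of all continuous maps from [X]
   to [0, 1], with the subspace topology. The closure is the same in [0, 1]^I
   as in R^I. *)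
Definition stone_cech : topologicalType :=
  set_type (closure (range cube_eval)).

Definition sc_embed (x : X) : stone_cech :=
  SigSub (mem_set (subset_closure (imageT cube_eval x))).

Definition far_point (p : stone_cech) : Prop :=
  ~ range sc_embed p /\
  forall D : set X, closed D -> discrete_subset D ->
    ~ closure (sc_embed @` D) p.

End StoneCech.

Section StoneCechFacts.
Variables (R : realType) (X : topologicalType).
Local Notation bX := (stone_cech R X).
Local Notation e := (@sc_embed R X).

Lemma unit_cube_proj_continuous (f : unit_map R X) :
  continuous (fun q : unit_cube R X => q f : R).
Proof. exact: (@proj_continuous {classic unit_map R X} (fun=> R) f). Qed.

Lemma unit_cube_hausdorff : hausdorff_space (unit_cube R X).
Proof.
apply: (@hausdorff_product {classic unit_map R X} (fun=> R)) => _.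
exact: Rhausdorff.
Qed.

Lemma cube_eval_continuous : continuous (@cube_eval R X).
Proof.
move=> x; apply/cvg_sup => f U /= [_ [[V oV <-] Vx /filterS]]; apply.
by case: (svalP f) => cf _; apply: cf; exact: open_nbhs_nbhs.
Qed.

Lemma sc_embed_continuous : continuous e.
Proof.
move=> x U [_ [[V oV <-] Vx /filterS]]; apply.
by apply: cube_eval_continuous; exact: open_nbhs_nbhs.
Qed.

Lemma stone_cech_compact : compact [set: bX].
Proof.
have cK : compact (closure (range (@cube_eval R X))).
  pose K : set (unit_cube R X) := [set q | forall f, (`[0, 1]%classic : set R) (q f)].
  have cptK : compact K.
    exact: (@tychonoff {classic unit_map R X} (fun=> R) (fun=> `[0, 1]%classic) (fun=> @segment_compact _ _ _)).
  apply: (subclosed_compact _ cptK); first exact: closed_closure.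
  rewrite (closure_id K).1; last exact: (compact_closed unit_cube_hausdorff).
  apply: closureS => _ [x _ <-] f.
  by case: (svalP f) => _; apply; exists x.
move=> F FF _.
have FG : ProperFilter (set_val @ F) := fmap_proper_filter _ FF.
have FK : (set_val @ F) (closure (range (@cube_eval R X))).
  apply: (@filterS _ F _ setT); last exact: filterT.
  by move=> -[q qK] _; exact: set_mem.
have [q [qK clq]] := cK _ FG FK.
exists (SigSub (mem_set qK)); split => // A B FA [_ [[V oV <-] Vq VB]].
have FA' : (set_val @ F) (set_val @` A) by apply: (@filterS _ F _ A) => // z Az; exists z.
have [_ [[z Az <-] Vz]] := clq _ _ FA' (open_nbhs_nbhs (conj oV Vq)).
by exists z; split => //; exact: VB.
Qed.

Lemma stone_cech_hausdorff : hausdorff_space bX.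
Proof.
move=> p q clpq; apply: val_inj; apply: unit_cube_hausdorff => A B pA qB.
have [z [Az Bz]] := clpq _ _ (@initial_continuous _ _ _ p _ pA)
  (@initial_continuous _ _ _ q _ qB).
by exists (set_val z).
Qed.

Lemma sc_embed_dense : closure (range e) = [set: bX].
Proof.
apply/seteqP; split => // -[q qK] _ U [_ [[V oV <-] Vq VU]].
have [_ [[x _ <-] Vx]] := set_mem qK V (open_nbhs_nbhs (conj oV Vq)).
by exists (e x); split; [exists x | exact: VU].
Qed.

Lemma sc_embed_inj : tychonoff_space X -> injective e.
Proof.
move=> [hX cX] x y exy; apply: contrapT => xy.
have cly : closed [set y].
  by apply: accessible_closed_set1; exact: hausdorff_accessible.
have /(@uniform_separatorP _ R)[f [cf f01 f0 f1]] := cX x _ cly xy.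
have : f x = f y :=
  congr1 (fun q : bX => set_val q (exist _ f (conj cf f01))) exy.
rewrite (f0 (f x)); last by exists x.
rewrite (f1 (f y)); last by exists y.
by move/eqP; rewrite eq_sym oner_eq0.
Qed.

Lemma sc_embed_initial : completely_regular_space X ->
  forall x U, nbhs x U -> exists2 V, nbhs (e x) V & e @^-1` V `<=` U.
Proof.
move=> cX x U; rewrite nbhsE => -[W [oW Wx] WU].
have /(@uniform_separatorP _ R)[f [cf f01 f0 f1]] :=
  cX x (~` W) (open_closedC oW) (fun nW => nW Wx).
pose g : unit_map R X := exist _ f (conj cf f01).
exists ((fun q : bX => set_val q g) @^-1` [set r | r < 1]).
  have c : continuous (fun q : bX => set_val q g : R).
    move=> q; apply: (@continuous_comp _ _ _ set_val (fun q : unit_cube R X => q g)).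
      exact: initial_continuous.
    exact: unit_cube_proj_continuous.
  apply: c; apply: open_nbhs_nbhs; split; first exact: open_lt.
  by change (f x < 1); rewrite (f0 (f x)) ?ltr01//; exists x.
move=> y; change (f y < 1 -> U y) => fy; apply/WU; apply: contrapT => nWy.
by move: fy; rewrite (f1 (f y)) ?ltxx//; exists y.
Qed.

Lemma sc_embed_extend (f : X -> R) : continuous f -> range f `<=` `[0, 1] ->
  exists2 g : bX -> R, continuous g & forall x, g (e x) = f x.
Proof.
move=> cf f01; exists (fun q => set_val q (exist _ f (conj cf f01))) => // q.
apply: (@continuous_comp _ _ _ set_val (fun q : unit_cube R X => q _)).
  exact: initial_continuous.
exact: unit_cube_proj_continuous.
Qed.

End StoneCechFacts.

(* Main.v *)
(* Every closed discrete set D is given a clopen neighbourhood W D in such a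
   way that no finitely many of the sets W D cover X.  By compactness some
   point of beta X is a zero of the extended indicators of all the W D, and
   such a point is far.

   Fix a partition of X into clopen pieces Y_n.  On Y_n, W D is the
   intersection of clopen neighbourhoods O_0, ..., O_(n-1) of D.  With O_i comes
   a family GG_i of non-empty open sets, starting from GG_0 = {Y_n}; near each
   d in D it has fewer than chi(d) = pi chi(d) members, so it is not a local
   pi-base at d and O_i can be taken to cover no member of GG_i.  The bases of
   all points are indexed by one well-order; the least level at which a
   difference U \ V of basic neighbourhoods meets G in GG_i and misses O_i is
   the rank of G, and GG_(i+1) consists of the traces on the sets G of all the
   differences of level at most the rank of G.  Near d in D these ranks are
   bounded by a single level having fewer than chi(d) predecessors, and
   infinite cardinals are idempotent, so GG_(i+1) is again small near D.  Given
   n sets D, one of them has the least rank at Y_n; its witness avoids its O_0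
   and lies in the family GG_1 of each of the others, and the argument goes on
   with these. *)
Require Import Defs.
From mathcomp Require Import all_boot all_order all_algebra.
From mathcomp Require Import all_classical all_reals all_analysis.
From mathcomp Require Import wochoice.

Set Implicit Arguments.
Unset Strict Implicit.
Unset Printing Implicit Defensive.
Import Order.TTheory GRing.Theory Num.Theory numFieldNormedType.Exports.
Local Open Scope classical_set_scope.
Local Open Scope card_scope.

(** * Cardinals *)

(** Choice turns the relation into a function, injective by the second hypothesis. A relation can be
    given by cases, without a total function on [T]. *)
Lemma card_le_of_rel (T U : Type) (A : set T) (B : set U) (F : T -> U -> Prop) :
  (forall a, A a -> exists2 b, B b & F a b) ->
  (forall a a' b, F a b -> F a' b -> a = a') -> A #<= B.
Proof.
move=> FAB Finj.
have /choice[f fP] (a : A) : exists b : B, F (set_val a) (set_val b).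
  have [b Bb Fab] := FAB _ (set_valP a).
  by exists (SigSub (mem_set Bb)).
apply/card_leP/injfunPex; exists f => // a a' _ _ e.
by apply: val_inj; apply: Finj (fP a) _; rewrite e; exact: fP.
Qed.

Lemma card_le_fun (T U : Type) (A : set T) (B : set U) :
  A #<= B -> B !=set0 ->
  exists2 f : T -> U, (forall a, B (f a)) &
    forall a a', A a -> A a' -> f a = f a' -> a = a'.
Proof.
move=> AB [b0 Bb0]; have /card_leP/injfunPex[g _ ginj] := AB.
have /choice[f fP] (a : T) : exists b, B b /\
    forall Aa : A a, b = set_val (g (SigSub (mem_set Aa))).
  have [Aa|nAa] := pselect (A a); last by exists b0; split.
  exists (set_val (g (SigSub (mem_set Aa)))); split; first exact: set_valP.
  by move=> Aa'; rewrite (Prop_irrelevance Aa Aa').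
exists f => [a|a a' Aa Aa' e]; first by have [] := fP a.
have /val_inj/ginj := etrans (esym ((fP a).2 Aa)) (etrans e ((fP a').2 Aa')).
by move=> /(_ (in_setT _) (in_setT _))/(congr1 set_val).
Qed.

Lemma card_leX (T T' U U' : Type) (A : set T) (A' : set T')
    (B : set U) (B' : set U') :
  A #<= A' -> B #<= B' -> A `*` B #<= A' `*` B'.
Proof.
have [->|/set0P A0] := eqVneq A' set0.
  by move=> /card_le0P -> _; rewrite set0X card_ge0.
have [->|/set0P B0] := eqVneq B' set0.
  by move=> _ /card_le0P ->; rewrite setX0 card_ge0.
move=> /card_le_fun/(_ A0)[f fA finj] /card_le_fun/(_ B0)[g gB ginj].
apply: (@card_le_of_rel _ _ _ _
  (fun p q => [/\ A p.1, B p.2 & q = (f p.1, g p.2)])) => [p [Ap Bp]|].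
  by exists (f p.1, g p.2) => //; split; [exact: fA|exact: gB].
move=> [a b] [a' b'] _ [/= Aa Bb ->] [/= Aa' Bb' [/finj ea /ginj eb]].
by rewrite ea // eb.
Qed.

(** Zorn's lemma on graphs of partial injections: a maximal one exhausts [A] or [B], since otherwise
    a pair of missed points could be added. *)
Lemma card_le_total (T U : Type) (A : set T) (B : set U) :
  A #<= B \/ B #<= A.
Proof.
pose P (F : set (T * U)) := [/\ F `<=` A `*` B,
  (forall a b b', F (a, b) -> F (a, b') -> b = b') &
  forall a a' b, F (a, b) -> F (a', b) -> a = a'].
have [F FP totF|F [[FAB Ffun Finj] Fmax]] := @Zorn_bigcup _ P.
  have join p q : (\bigcup_(X in F) X) p -> (\bigcup_(X in F) X) q ->
      exists X, [/\ P X, X p & X q].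
    move=> [X FX Xp] [Y FY Yq]; have [/(_ _ Xp) Yp|/(_ _ Yq) Xq] := totF _ _ FX FY.
      by exists Y; split => //; exact: FP.
    by exists X; split => //; exact: FP.
  split.
  - by move=> p [X /FP[XAB _ _]] /XAB.
  - by move=> a b b' h /(join _ _ h)[X [[_ Xfun _]]]; exact: Xfun.
  - by move=> a a' b h /(join _ _ h)[X [[_ _ Xinj]]]; exact: Xinj.
have [dF|/existsNP[a /not_implyP[Aa naF]]] :=
    pselect (forall a, A a -> exists b, F (a, b)).
  left; apply: (@card_le_of_rel _ _ _ _ (fun a b => F (a, b))) => // a /dF[b Fab].
  by exists b => //; have [] := FAB _ Fab.
have [rF|/existsNP[b /not_implyP[Bb nbF]]] :=
    pselect (forall b, B b -> exists a, F (a, b)).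
  right; apply: (@card_le_of_rel _ _ _ _ (fun b a => F (a, b))); last first.
    by move=> b b' a'; exact: Ffun.
  by move=> b /rF[a' Fab]; exists a' => //; have [] := FAB _ Fab.
case: (Fmax ((a, b) |` F)).
  by split=> [p Fp|/(_ (a, b) (or_introl erefl)) Fab]; [right|apply: naF; exists b].
split.
- by move=> p [->|/FAB].
- move=> a' b1 b2 [[-> ->]|F1] [[]|F2]; do ?[by move=> ->|by []].
  + by case: naF; exists b2.
  + by move=> a'a; case: naF; exists b1; rewrite -a'a.
  + exact: Ffun F1 F2.
- move=> a1 a2 b' [[-> ->]|F1] [[]|F2]; do ?[by move=> -> _|by []].
  + by case: nbF; exists a2.
  + by move=> _ bb; case: nbF; exists a1; rewrite -bb.
  + exact: Finj F1 F2.
Qed.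

(** * Idempotence of infinite cardinals *)

Definition diag_dom (T : Type) (F : set (T * T * T)) : set T :=
  [set x | exists y z, F (x, y, z)].

(** Relational form of an injection from [S * S] to [S], where [S = diag_dom F] is read off the
    graph itself. *)
Definition square_pairing (T : Type) (A : set T) (F : set (T * T * T)) : Prop :=
  [/\ forall x y z, F (x, y, z) ->
        [/\ diag_dom F x, diag_dom F y, diag_dom F z & A x],
      forall x y, diag_dom F x -> diag_dom F y -> exists z, F (x, y, z),
      forall p q z, F (p, z) -> F (q, z) -> p = q &
      infinite_set (diag_dom F)].

Lemma square_pairing_fun (T : Type) (A : set T) (F : set (T * T * T)) :
  square_pairing A F -> exists f : T -> T -> T,
   (forall x y, diag_dom F x -> diag_dom F y -> F (x, y, f x y)) /\
   (forall x y x' y', diag_dom F x -> diag_dom F y -> diag_dom F x' ->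
      diag_dom F y' -> f x y = f x' y' -> x = x' /\ y = y').
Proof.
move=> [_ Ftot Finj _].
have /choice[f fP] (p : T * T) : exists z,
    diag_dom F p.1 -> diag_dom F p.2 -> F (p, z).
  have [[Fx Fy]|nF] := pselect (diag_dom F p.1 /\ diag_dom F p.2).
    by have [z Fz] := Ftot _ _ Fx Fy; exists z; move: Fz; rewrite -surjective_pairing.
  by exists p.1 => Fx Fy; case: nF.
exists (fun x y => f (x, y)); split => [x y Fx Fy|x y x' y' Fx Fy Fx' Fy' e].
  exact: (fP (x, y)).
have := fP (x, y) Fx Fy; rewrite e => /Finj/(_ (fP (x', y') Fx' Fy'))[-> ->].
by [].
Qed.

(** With a copy [g(S)] of [S] in the complement, the pairing grows to the union of both. New pairs
    take values in [g(S)], away from the old values in [S]. *)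
Lemma square_pairing_ext (T : Type) (A : set T) (F : set (T * T * T)) :
  square_pairing A F -> diag_dom F #<= A `\` diag_dom F ->
  exists2 G, square_pairing A G & F `<=` G /\ ~ G `<=` F.
Proof.
move=> Fsp; have [f [fF finj]] := square_pairing_fun Fsp.
move: (Fsp) => [Fdom Ftot Finj Finf]; set S := diag_dom F in Fsp fF finj *.
have fS x y : S x -> S y -> S (f x y).
  by move=> Sx Sy; have [] := Fdom _ _ _ (fF _ _ Sx Sy).
have /infiniteP/card_le_fun/(_ (infinite_setN0 Finf))[c cS cinj] := Finf.
have {}cinj m n : c m = c n -> m = n by exact: cinj.
move=> SAS; have AS0 : A `\` S !=set0.
  have /card_leP[g] := SAS; have := g (SigSub (mem_set (cS 0))) => -[x xAS].
  by exists x; exact: set_mem.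
have [g gAS ginj] := card_le_fun SAS AS0.
have Sg x : ~ S (g x) by have [] := gAS x.
pose e (b : bool) x := if b then g x else x.
have einj b b' x x' : S x -> S x' -> e b x = e b' x' -> b = b' /\ x = x'.
  move=> Sx Sx'; case: b; case: b' => /= h; split => //.
  - exact: ginj.
  - by case: (Sg x); rewrite h.
  - by case: (Sg x); rewrite h.
  - by case: (Sg x'); rewrite -h.
  - by case: (Sg x'); rewrite -h.
(* The numbers 1, 2 and 3 tag the three kinds of new pairs, according to which components lie in the
   image of [g]. *)
pose N := [set p : T * T * T | exists b b' x y,
  [/\ b || b', S x, S y & p = (e b x, e b' y, g (f (f x y) (c (b + b'.*2)%N)))]].
have SG : diag_dom (F `|` N) = [set x | exists b y, S y /\ x = e b y].
  apply/seteqP; split => x.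
    move=> [y [z [/Fdom[Sx _ _ _]|]]]; first by exists false, x.
    by move=> [b [b' [x0 [y0 [_ Sx0 _ [-> _ _]]]]]]; exists b, x0.
  move=> [b [y [Sy ->]]].
  exists (g (c 0)), (g (f (f y (c 0)) (c (b + true.*2)%N))); right.
  by exists b, true, y, (c 0); rewrite orbT; split => //; exact: cS.
have eA b x : S x -> A (e b x).
  by case: b => //= [_|[y [z /Fdom[]//]]]; have [] := gAS x.
exists (F `|` N); last first.
  split => [p Fp|/(_ (g (c 0), g (c 0), g (f (f (c 0) (c 0)) (c 3))))]; first by left.
  have h : N (g (c 0), g (c 0), g (f (f (c 0) (c 0)) (c 3))).
    by exists true, true, (c 0), (c 0); split => //; exact: cS.
  by move=> /(_ (or_intror h))/Fdom[] /Sg.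
split.
- rewrite SG => x y z [Fxyz|].
    have [Sx Sy Sz Ax] := Fdom _ _ _ Fxyz.
    by split => //; [exists false, x|exists false, y|exists false, z].
  move=> [b [b' [x0 [y0 [_ Sx Sy [-> -> ->]]]]]].
  split; [by exists b, x0|by exists b', y0| |exact: eA].
  exists true, (f (f x0 y0) (c (b + b'.*2)%N)); split => //.
  by apply: (fS); [exact: fS|exact: cS].
- rewrite SG => x y [b [x0 [Sx ->]]] [b' [y0 [Sy ->]]].
  have [bb|] := boolP (b || b').
    by exists (g (f (f x0 y0) (c (b + b'.*2)%N))); right; exists b, b', x0, y0.
  by case: b; case: b' => //= _; have [z Fz] := Ftot _ _ Sx Sy; exists z; left.
- move=> p q z [Fp|Np] [Fq|Nq].
  + exact: Finj Fp Fq.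
  + case: p Fp Nq => x y Fp [b [b' [x0 [y0 [_ _ _ [_ zE]]]]]].
    by have [_ _ Sz _] := Fdom _ _ _ Fp; rewrite zE in Sz; case: (Sg _ Sz).
  + case: q Fq Np => x y Fq [b [b' [x0 [y0 [_ _ _ [_ zE]]]]]].
    by have [_ _ Sz _] := Fdom _ _ _ Fq; rewrite zE in Sz; case: (Sg _ Sz).
  + case: Np => [b1 [b1' [x1 [y1 [_ Sx1 Sy1 [pE zE]]]]]]; rewrite pE.
    case: Nq; rewrite zE => [b2 [b2' [x2 [y2 [_ Sx2 Sy2 [qE h]]]]]]; rewrite qE.
    have h1 := ginj _ _ (fS _ _ (fS _ _ Sx1 Sy1) (cS _))
      (fS _ _ (fS _ _ Sx2 Sy2) (cS _)) h.
    have [h2 /cinj h3] := finj _ _ _ _ (fS _ _ Sx1 Sy1) (cS _)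
      (fS _ _ Sx2 Sy2) (cS _) h1.
    have [-> ->] := finj _ _ _ _ Sx1 Sy1 Sx2 Sy2 h2.
    by move: h3; case: b1 {pE zE h h1}; case: b1'; case: b2 {qE}; case: b2'.
- rewrite SG; apply: sub_infinite_set Finf => x Sx; by exists false, x.
Qed.

(* Zorn's lemma for injections [S * S -> S] with [S] an infinite subset of [A];
   a maximal one has a complement [A \ S] that is no larger than [S]. *)
Lemma card_setX_infinite (T : Type) (A : set T) :
  infinite_set A -> A `*` A #<= A.
Proof.
move=> Ainf.
have /infiniteP/card_le_fun/(_ (infinite_setN0 Ainf))[c cA cinj] := Ainf.
have {}cinj m n : c m = c n -> m = n by exact: cinj.
pose F0 := [set p : T * T * T | exists m n, p = (c m, c n, c (choice.pickle (m, n)))].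
have F0c m : diag_dom F0 (c m) by exists (c 0), (c (choice.pickle (m, 0))), m, 0.
have F0sp : square_pairing A F0.
  split.
  - by move=> x y z [m [n [-> -> ->]]].
  - move=> x y [_ [_ [m [_ [-> _ _]]]]] [_ [_ [n [_ [-> _ _]]]]].
    by exists (c (choice.pickle (m, n))), m, n.
  - move=> p q z [m [n [-> ->]]] [m' [n' [-> /cinj/(pcan_inj choice.pickleK)]]].
    by move=> [-> ->].
  - apply/infiniteP; apply: card_le_trans (subset_card_le (A := range c) _).
      by rewrite (card_le_eqr (inj_card_eq _)) // => m n _ _; exact: cinj.
    by move=> _ [m _ <-].
pose P := {F | square_pairing A F}.
pose R (F G : P) := `[< sval F `<=` sval G >].
have [|||[F Fsp] Fmax] := @ZL_preorder P (exist _ F0 F0sp) R.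
- by move=> F; exact/asboolP.
- move=> F G H /asboolP FG /asboolP GH; exact/asboolP/(subset_trans FG).
- move=> C totC; have [->|/set0P[F1 CF1]] := eqVneq C set0.
    by exists (exist _ F0 F0sp).
  pose U := \bigcup_(F in C) sval F.
  have join p q : U p -> U q -> exists F, [/\ C F, sval F p & sval F q].
    move=> [F CF Fp] [G CG Gq].
    have [/asboolP/(_ _ Fp) Gp|/asboolP/(_ _ Gq) Fq] := totC _ _ CF CG.
      by exists G.
    by exists F.
  have Udom F : C F -> diag_dom (sval F) `<=` diag_dom U.
    by move=> CF x [y [z Fz]]; exists y, z, F.
  suff Usp : square_pairing A U.
    by exists (exist _ U Usp) => F CF; apply/asboolP => p Fp; exists F.
  split.
  - move=> x y z [F CF Fxyz]; have [Fdom _ _ _] := svalP F.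
    by have [Fx Fy Fz Ax] := Fdom _ _ _ Fxyz; split => //; exact: (Udom _ CF).
  - move=> x y [x1 [x2 Ux]] [y1 [y2 Uy]]; have [F [CF Fx Fy]] := join _ _ Ux Uy.
    have [_ Ftot _ _] := svalP F.
    have [z Fz] : exists z, sval F (x, y, z).
      by apply: Ftot; [exists x1, x2|exists y1, y2].
    by exists z, F.
  - move=> p q z Up /(join _ _ Up)[F [CF]]; have [_ _ Finj _] := svalP F; exact: Finj.
  - by have [_ _ _] := svalP F1; apply: sub_infinite_set; exact: Udom.
set S := diag_dom F in Fmax.
have [f [fF finj]] := square_pairing_fun Fsp.
move: (Fsp) => [Fdom _ _ Finf].
have fS x y : S x -> S y -> S (f x y).
  by move=> Sx Sy; have [] := Fdom _ _ _ (fF _ _ Sx Sy).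
have SA : S `<=` A by move=> x [y [z /Fdom[]]].
have ASS : A `\` S #<= S.
  have [//|] := card_le_total (A `\` S) S.
  move=> /(square_pairing_ext Fsp)[G Gsp [FG nGF]].
  case: nGF; apply/asboolP; apply: (Fmax (exist _ G Gsp)); exact/asboolP.
have /infiniteP/card_le_fun/(_ (infinite_setN0 Finf))[d dS dinj] := Finf.
have [h hS hinj] := card_le_fun ASS (infinite_setN0 Finf).
(* The tags [d 0] and [d 1] keep the images of [S] and of its complement disjoint. *)
have AS : A #<= S.
  apply: (@card_le_of_rel _ _ _ _ (fun a b => (S a /\ b = f a (d 0)) \/
      ((A `\` S) a /\ b = f (h a) (d 1)))) => [a Aa|].
    have [Sa|nSa] := pselect (S a).
      by exists (f a (d 0)); [exact: fS _ (dS 0)|left].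
    by exists (f (h a) (d 1)); [exact: fS _ (dS 1)|right].
  move=> a a' b [[Sa ->]|[Sa ->]] [[Sa' e]|[Sa' e]].
  - by case: (finj _ _ _ _ Sa (dS 0) Sa' (dS 0) e).
  - by case: (finj _ _ _ _ Sa (dS 0) (hS a') (dS 1) e) => _ /dinj-/(_ I I).
  - by case: (finj _ _ _ _ (hS a) (dS 1) Sa' (dS 0) e) => _ /dinj-/(_ I I).
  - by case: (finj _ _ _ _ (hS a) (dS 1) (hS a') (dS 1) e) => /hinj-/(_ Sa Sa').
apply: card_le_trans (card_leX AS AS) _.
apply: card_le_trans (subset_card_le SA).
apply: (@card_le_of_rel _ _ _ _ (fun p b => [/\ S p.1, S p.2 & b = f p.1 p.2])).
  by move=> p [Sp Sq]; exists (f p.1 p.2); [exact: fS|].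
move=> [x y] [x' y'] b [/= Sx Sy ->] [/= Sx' Sy' /finj].
by move=> /(_ Sx Sy Sx' Sy')[-> ->].
Qed.

(** The larger factor decides: if it is finite, so is the product; if it is infinite, it absorbs the
    product by idempotence. *)
Lemma card_ltX (V T U : Type) (B : set V) (P : set T) (Q : set U) :
  infinite_set B -> ~ (B #<= P) -> ~ (B #<= Q) -> ~ (B #<= P `*` Q).
Proof.
wlog PQ : T U P Q / P #<= Q => [wl Binf nP nQ|].
  have [PQ|QP] := card_le_total P Q; first exact: wl.
  have := wl _ _ _ _ QP Binf nQ nP; apply: contra_not => BPQ.
  apply: card_le_trans BPQ _; apply: (@card_le_of_rel _ _ _ _
    (fun p q => q = (p.2, p.1))) => [p [Pp Qp]|[a b] [a' b'] _ ->].
    by exists (p.2, p.1).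
  by move=> [-> ->].
move=> Binf _ nQ BPQ; have [Qfin|Qinf] := pselect (finite_set Q).
  apply: Binf; apply: card_le_finite BPQ _; apply: finite_setX => //.
  exact: card_le_finite PQ Qfin.
apply: nQ; apply: card_le_trans BPQ _.
by apply: card_le_trans (card_leX PQ (card_lexx Q)) _; exact: card_setX_infinite.
Qed.

(** * Well-ordered levels of neighbourhoods *)

Definition has_least (L : Type) (le : L -> L -> Prop) : Prop :=
  forall P : set L, P !=set0 -> exists2 m, P m & forall a, P a -> le m a.

Lemma has_least_total (L : Type) (le : L -> L -> Prop) :
  has_least le -> forall a b, le a b \/ le b a.
Proof.
move=> leP a b; have [|m mab mP] := leP [set a; b]; first by exists a; left.
by move: mab mP => [->|->] mP; [left; apply: mP; right|right; apply: mP; left].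
Qed.

Lemma exists_well_order (T : Type) : exists le : T -> T -> Prop,
  [/\ forall a b c, le a b -> le b c -> le a c,
      forall a b, le a b -> le b a -> a = b & has_least le].
Proof.
have [R Rwo] := well_ordering_principle {classic T}.
have least : has_least (fun a b : T => R a b).
  move=> P [x Px]; have [|m [[mP mmin] _]] := Rwo (fun a => `[< P a >]).
    by exists x; apply/asboolP.
  by exists m => [|a Pa]; [exact/asboolP|apply: mmin; exact/asboolP].
have refl a : R a a by case: (has_least_total least a a).
have anti (a b : T) : R a b -> R b a -> a = b.
  move=> ab ba; have [|m [_ mU]] := Rwo (fun c => `[< c = a \/ c = b >]).
    by exists a; apply/asboolP; left.
  rewrite -(mU a); last first.
    split; first by apply/asboolP; left.
    by move=> c /asboolP[->//|->].
  apply: mU; split; first by apply/asboolP; right.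
  by move=> c /asboolP[->|->].
exists R; split => // a b c ab bc.
have [|m mabc mP] := least [set d | [\/ d = a, d = b | d = c]].
  by exists a; apply: Or31.
case: mabc mP => -> mP.
- by apply: mP; exact: Or33.
- by rewrite (anti a b ab (mP _ (Or31 _ _ erefl))).
- by rewrite -(anti b c bc (mP _ (Or32 _ _ erefl))).
Qed.

(** The naturals are put before [T], so that a level [inl n] has finitely many predecessors and is
    small compared with any infinite base. *)
Lemma exists_well_order_nat_sum (T : Type) :
  exists le : nat + T -> nat + T -> Prop,
  [/\ forall a b c, le a b -> le b c -> le a c,
      forall a b, le a b -> le b a -> a = b,
      has_least le & forall n, finite_set [set a | le a (inl n)]].
Proof.
have [R [Rtrans Ranti Rleast]] := exists_well_order T.
exists (fun a b : nat + T => match a, b return Prop with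
  | inl m, inl n => is_true (m <= n)%N | inl _, inr _ => True
  | inr _, inl _ => False | inr x, inr y => R x y end).
split.
- move=> [m|x] [n|y] [p|z] //; first exact: leq_trans.
  exact: Rtrans.
- move=> [m|x] [n|y] // h h'; last by rewrite (Ranti x y).
  by congr inl; apply/eqP; rewrite eqn_leq h.
- move=> P [a Pa]; have [[n Pn]|nP] := pselect (exists n, P (inl n)).
    have ex : exists n, `[< P (inl n) >] by exists n; exact/asboolP.
    exists (inl (ex_minn ex)); case: ex_minnP => m /asboolP // Pm mP [k|//] Pk.
    by apply: mP; exact/asboolP.
  have [|m Pm mP] := Rleast (fun x => P (inr x)).
    by case: a Pa => [n|x] Pa; [case: nP; exists n|exists x].
  by exists (inr m) => // -[n|x] Px; [apply: nP; exists n|exact: mP].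
- move=> n; apply: sub_finite_set (finite_image inl (finite_II n.+1)).
  by move=> [m|//] mn; exists m.
Qed.

(** * Clopen bases and levels in countable crowded spaces *)

(** A separating function has a countable range, which cannot contain an interval of positive
    measure. At an omitted value [r] the conditions [f < r] and [f <= r] define the same set, which
    is thus clopen. *)
Lemma countable_clopen_base (R : realType) (X : topologicalType) :
  countable [set: X] -> completely_regular_space X ->
  forall (x : X) W, nbhs x W -> exists V, [/\ clopen V, V x & V `<=` W].
Proof.
move=> cX crX x W; rewrite nbhsE => -[W' [oW' W'x] W'W].
have /(@uniform_separatorP _ R)[f [cf f01 f0 f1]] :=
  crX x (~` W') (open_closedC oW') (fun nW => nW W'x).
have [r r01 nr] : exists2 r : R, (0 < r < 1)%R & ~ range f r.
  apply: contrapT => H; have sub : `]0%R, 1%R[ `<=` range f.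
    move=> r; rewrite /= in_itv /= => r01; apply: contrapT => nr.
    by apply: H; exists r.
  have c : countable (range f).
    by apply: sub_countable cX; exact: card_image_le.
  have := countable_lebesgue_measure0 (sub_countable (subset_card_le sub) c).
  rewrite lebesgue_measure_itv /= lte_fin ltr01 oppr0 adde0 => /eqP.
  by rewrite eqe oner_eq0.
have [r0 r1] := andP r01.
exists (f @^-1` [set y | (y < r)%R]); split.
- split; first by apply: open_comp => [y _|]; [exact: cf|exact: open_lt].
  have -> : f @^-1` [set y | (y < r)%R] = f @^-1` [set y | (y <= r)%R].
    apply/seteqP; split => y /=; first exact: ltW.
    rewrite le_eqVlt => /orP[/eqP fy|//]; case: nr; by exists y.
  by apply: closed_comp => [y _|]; [exact: cf|exact: closed_le].
- by rewrite /= (f0 (f x)) //; exists x.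
- move=> y /= fy; apply: W'W; apply: contrapT => nW'y.
  by move: fy; rewrite (f1 (f y)); [rewrite ltNge (ltW r1)|exists y].
Qed.

(** Each of finitely many neighbourhoods of [x] contains a point other than [x]; the complement of
    these points is a neighbourhood of [x] that includes none of the given ones. *)
Lemma local_base_infinite (X : topologicalType) (x : X) (B : set (set X)) :
  hausdorff_space X -> isolated [set: X] = set0 -> local_base x B ->
  infinite_set B.
Proof.
move=> hX iX [Bo Bb] Bfin.
have /choice[y yP] (U : set X) : exists y, B U -> U y /\ y <> x.
  have [BU|nBU] := pselect (B U); last by exists x.
  apply: contrapT => H; suff : isolated [set: X] x by rewrite iX.
  split; first exact: in_setT.
  exists U; first exact: (open_nbhs_nbhs (Bo _ BU)).
  rewrite setIT; apply/seteqP; split => [z Uz|_ ->]; last by have [] := Bo _ BU.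
  by apply: contrapT => zx; apply: H; exists z.
have cF : closed (y @` B).
  have [+ _] := @accessible_finite_set_closed X; apply; last exact: finite_image.
  exact: hausdorff_accessible.
have [|U BU] := Bb (~` (y @` B)).
- apply: open_nbhs_nbhs; split; first exact: closed_openC.
  by move=> [U BU yx]; have [] := yP _ BU.
- by have [Uy _] := yP _ BU; move=> /(_ _ Uy); apply; exists U.
Qed.

(* [A a] collects the differences of two basic neighbourhoods of level at most
   [a], in a single well-order that measures the bases of all points at once:
   the levels occurring in the base of [d] have fewer than [B d] predecessors. *)
Lemma exists_levels (X : topologicalType) (B : X -> set (set X)) :
  hausdorff_space X -> isolated [set: X] = set0 -> countable [set: X] ->
  (forall (x : X) W, nbhs x W -> exists V, [/\ clopen V, V x & V `<=` W]) ->
  (forall d, local_base d (B d)) ->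
  (forall d C, local_pi_base d C -> B d #<= C) ->
  exists (L : Type) (le : L -> L -> Prop) (A : L -> set (set X)),
  [/\ has_least le, forall a b, le a b -> A a `<=` A b,
      forall a, A a `<=` clopen &
      forall d W (G : set (set X)), nbhs d W -> G `<=` open -> ~ (B d #<= G) ->
      exists U O a,
      [/\ [/\ clopen U, clopen O, O d, O `<=` U & U `<=` W],
          A a (U `\` O), ~ (B d #<= A a) &
          forall g, G g -> g `&` U !=set0 -> g `&` (U `\` O) !=set0]].
Proof.
move=> hX iX cX zX Bbase Bpi.
have Binf d := local_base_infinite hX iX (Bbase d).
have /countable_injP[f finj] := cX.
have {}finj x y : f x = f y -> x = y by apply: finj; exact: in_setT.
have [le [letrans leanti leleast lefin]] := exists_well_order_nat_sum (set X).
have letot := has_least_total leleast.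
(* [seg a] holds the strict predecessors of [a]; [S d] holds the levels with fewer than [B d]
   predecessors. *)
pose seg a := [set b | ~ le a b].
pose S d := [set a | ~ (B d #<= seg a)].
(* The least level outside [S d], if any, has at least [B d] predecessors, all of them in [S d];
   otherwise [inr] embeds [B d]. *)
have BS d : B d #<= S d.
  have [[a nSa]|SX] := pselect (exists a, ~ S d a); last first.
    apply: (@card_le_of_rel _ _ _ _ (fun U a => a = inr U)) => [U BU|U V _ ->].
      by exists (inr U) => //; apply: contrapT => nS; apply: SX; exists (inr U).
    by move=> [].
  have [|m nSm mP] := leleast (~` S d); first by exists a.
  have Bm : B d #<= seg m by exact: contrapT.
  apply: card_le_trans Bm _; apply: subset_card_le => b nmb.
  by apply: contrapT => /mP.
have segfin n : finite_set (seg (inl n)).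
  by apply: sub_finite_set (lefin n) => a; have [] := letot a (inl n).
have Snat d n : S d (inl n) by move=> /card_le_finite/(_ (segfin n)); exact: Binf.
have small_le d a : S d a -> ~ (B d #<= [set b | le b a]).
  move=> Sa Ble; have [seg0|/set0P[s0 s0P]] := eqVneq (seg a) set0.
    apply: (Binf d); apply: card_le_finite Ble _.
    apply: sub_finite_set (finite_set1 a) => b /= ba; apply: leanti => //.
    by apply: contrapT => nab; have : seg a b by []; rewrite seg0.
  apply: (card_ltX (Binf d) Sa) (_ : ~ (B d #<= [set: bool])) _ => [Bb|].
    by apply: (Binf d); apply: card_le_finite Bb _; exact: finite_finset.
  apply: card_le_trans Ble _; apply: (@card_le_of_rel _ _ _ _ (fun b p =>
    (~ le a b /\ p = (b, true)) \/ (b = a /\ p = (s0, false)))) => [b ba|].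
    have [ab|nab] := pselect (le a b).
      by exists (s0, false) => //; right; split => //; exact: leanti.
    by exists (b, true) => //; left.
  by move=> b b' _ [[_ ->]|[-> ->]] [[_ e]|[-> e]]; move: e => /pair_equal_spec[].
(* Clopen neighbourhoods of [d] are indexed through an injection of [B d] into [S d]; all other
   levels get the whole space. *)
have /choice[u uP] (d : X) : exists u : nat + set X -> set X,
    (forall a, clopen (u a) /\ u a d) /\
    forall W, nbhs d W -> exists2 a, S d a & u a `<=` W.
  have [j jS jinj] := card_le_fun (BS d) (ex_intro _ (inl 0) (Snat d 0)).
  have /choice[u uP] a : exists V, [/\ clopen V, V d &
      forall b, B d b -> j b = a -> V `<=` b].
    have [[b Bb ja]|nb] := pselect (exists2 b, B d b & j b = a); last first.
      exists setT; split; [exact: clopenT|by []|].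
      by move=> b Bb ja; case: nb; exists b.
    have [V [cV Vd Vb]] := zX _ _ (open_nbhs_nbhs ((Bbase d).1 _ Bb)).
    exists V; split => // b' Bb' ja'.
    by rewrite (jinj b' b) // ja' ja.
  exists u; split => [a|W dW]; first by have [] := uP a.
  have [b Bb bW] := (Bbase d).2 _ dW; exists (j b) => //.
  by have [_ _ /(_ _ Bb erefl)/subset_trans] := uP (j b); exact.
(* The point [x] is bounded in level too, so that a level in [S d] confines [(x, b, c)] to a product
   of three small sets. *)
pose A a := [set C | exists x b c,
  [/\ le (inl (f x)) a, le b a, le c a & C = u x b `\` u x c]].
have max3 d a b c : S d a -> S d b -> S d c ->
    exists2 m, S d m & [/\ le a m, le b m & le c m].
  have max2 a' b' : S d a' -> S d b' -> exists2 m, S d m & le a' m /\ le b' m.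
    have refl e : le e e by have [] := letot e e.
    by move=> ? ?; have [?|?] := letot a' b'; [exists b'|exists a'].
  move=> Sa Sb Sc; have [m Sm [am bm]] := max2 _ _ Sa Sb.
  have [m' Sm' [mm' cm']] := max2 _ _ Sm Sc.
  by exists m' => //; split => //; exact: letrans mm'.
have Asmall d a : S d a -> ~ (B d #<= A a).
  move=> Sa BA; have nle := small_le _ _ Sa.
  have nX : ~ (B d #<= [set x | le (inl (f x)) a]).
    move=> Bx; apply: nle; apply: card_le_trans Bx _.
    apply: (@card_le_of_rel _ _ _ _ (fun x b => b = inl (f x))) => [x xa|x y _ ->].
      by exists (inl (f x)).
    by move=> [/finj].
  apply: (card_ltX (Binf d) nX (card_ltX (Binf d) nle nle)).
  apply: card_le_trans BA _.
  apply: card_le_trans (card_image_le (fun p => u p.1 p.2.1 `\` u p.1 p.2.2) _).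
  by apply: subset_card_le => _ [x [b [c [xa ba ca ->]]]]; exists (x, (b, c)).
exists (nat + set X)%type, le, A; split => //.
- move=> a b ab C [x [b' [c [xa ba ca ->]]]]; exists x, b', c.
  by split => //; apply: letrans ab.
- move=> a C [x [b [c [_ _ _ ->]]]]; rewrite setDE; apply: clopenI.
    by have [/(_ b)[]] := uP x.
  by apply: (@clopenC _ _ set0); have [/(_ c)[]] := uP x.
- move=> d W G dW Gopen nBG; have [ucl ubase] := uP d.
  have [a1 Sa1 a1W] := ubase _ dW.
  pose P := [set g `&` u d a1 | g in [set g | G g /\ g `&` u d a1 !=set0]].
  (* The traces on [u d a1] are too few for a local pi-base at [d], so some neighbourhood [V] of [d]
     includes none of them; [O] is then taken inside [V]. *)
  have nP : ~ local_pi_base d P.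
    move=> /Bpi BP; apply: nBG; apply: card_le_trans BP _.
    apply: card_le_trans (card_image_le _ _) _.
    by apply: subset_card_le => g [].
  have [V dV VP] : exists2 V, nbhs d V & forall g, G g -> g `&` u d a1 !=set0 ->
      ~ g `&` u d a1 `<=` V.
    apply: contrapT => H; apply: nP; split.
      move=> _ [g [Gg g0] <-]; split => //; apply: openI; first exact: Gopen.
      by have [[]] := ucl a1.
    move=> V dV; apply: contrapT => nV; apply: H; exists V => // g Gg g0 gV.
    by apply: nV; exists (g `&` u d a1) => //; exists g.
  have [|a2 Sa2 a2V] := ubase (V `&` u d a1).
    apply: filterI => //; apply: open_nbhs_nbhs; split; last exact: (ucl _).2.
    by have [[]] := ucl a1.
  have [m Sm [a1m a2m dm]] := max3 _ _ _ _ Sa1 Sa2 (Snat d (f d)).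
  exists (u d a1), (u d a2), m; split.
  + split => //; [exact: (ucl _).1|exact: (ucl _).1|exact: (ucl _).2|].
    by move=> z /a2V[].
  + by exists d, a1, a2.
  + exact: Asmall.
  + move=> g Gg g0; have /existsNP[z /not_implyP[[gz uz] nVz]] := VP _ Gg g0.
    by exists z; split => //; split => // /a2V[].
Qed.

(** * Refinements of families of open sets *)

Lemma clopen_bigcap_lt (X : topologicalType) (O : nat -> set X) (n : nat) :
  (forall i, clopen (O i)) -> clopen (\bigcap_(i < n) O i).
Proof.
move=> cO; elim: n => [|n IH].
  by rewrite (_ : \bigcap_(i < 0) O i = setT) ?bigcap_mkord ?big_ord0 //; exact: clopenT.
rewrite (_ : \bigcap_(i < n.+1) O i = \bigcap_(i < n) O i `&` O n).
  exact: clopenI.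
by rewrite !bigcap_mkord big_ord_recr.
Qed.

(** The complement is the union of the open sets [Q i \ O i], because each piece meets only its own
    [O i]. *)
Lemma clopen_bigcup_partition (X : topologicalType) (I : Type)
    (Q O : I -> set X) :
  (forall i, clopen (Q i)) -> (forall i, clopen (O i)) ->
  (forall i, O i `<=` Q i) -> (forall z, exists i, Q i z) ->
  (forall i j z, Q i z -> Q j z -> i = j) -> clopen (\bigcup_i O i).
Proof.
move=> cQ cO OQ Qcov Qdisj; split.
  by apply: bigcup_open => i _; have [] := cO i.
rewrite -openC (_ : ~` _ = \bigcup_i (Q i `\` O i)).
  apply: bigcup_open => i _; rewrite setDE; apply: openI; first by have [] := cQ i.
  by apply: closed_openC; have [] := cO i.
apply/seteqP; split => z.
  move=> nO; have [i Qz] := Qcov z; exists i => //; split => // Oz.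
  by apply: nO; exists i.
by move=> [i _ [Qz nOz]] [j _ Oz]; apply: nOz; rewrite (Qdisj i j z) //; exact: OQ.
Qed.

(** Along an enumeration of [X], each [N x] loses the finitely many earlier ones. The last clause
    serves for a discrete set: its points are kept in their own pieces. *)
Lemma clopen_partition_shrink (X : topologicalType) (N : X -> set X) :
  countable [set: X] -> (forall x, clopen (N x) /\ N x x) ->
  exists Q : X -> set X,
  [/\ forall x, clopen (Q x) /\ Q x `<=` N x, forall z, exists x, Q x z,
      forall x y z, Q x z -> Q y z -> x = y &
      forall x, (forall y, N y x -> x = y) -> Q x x].
Proof.
move=> /countable_injP[f finj] cN.
have {}finj : injective f by move=> x y; apply: finj; exact: in_setT.
pose Q x := N x `\` \bigcup_(y in [set y | (f y < f x)%N]) N y.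
exists Q; split.
- move=> x; split; last by move=> z [].
  rewrite /Q setDE; apply: clopenI; first exact: (cN x).1.
  apply: (@clopenC _ _ set0); elim: (f x) => [|n IH].
    rewrite (_ : \bigcup_(y in _) _ = set0); first exact: clopen0.
    by apply/seteqP; split => z // [].
  have [[y fy]|ny] := pselect (exists y, f y = n).
    rewrite (_ : \bigcup_(y in _) _ =
      \bigcup_(y in [set y | (f y < n)%N]) N y `|` N y).
      by apply: clopenU => //; exact: (cN y).1.
    apply/seteqP; split => [z [w /= + Nw]|z [[w /= wn Nw]|Ny]].
    - rewrite ltnS leq_eqVlt -fy => /orP[/eqP/finj wy|wy]; first by right; rewrite -wy.
      by left; exists w; rewrite // /= -fy.
    - by exists w => //=; exact: ltnW.
    - by exists y; rewrite //= fy.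
  rewrite (_ : \bigcup_(y in _) _ = \bigcup_(y in [set y | (f y < n)%N]) N y) //.
  apply/seteqP; split => z [w /= wn Nw]; exists w => //=; last exact: ltnW.
  by rewrite ltn_neqAle -ltnS wn andbT; apply/eqP => wn'; apply: ny; exists w.
- move=> z; have ex : exists n, `[< exists2 x, f x = n & N x z >].
    by exists (f z); apply/asboolP; exists z => //; exact: (cN z).2.
  case: (ex_minnP ex) => _ /asboolP[x <- Nx] mP; exists x; split => // -[y /= yx Ny].
  by move: yx; rewrite ltnNge mP //; apply/asboolP; exists y.
- move=> x y z [Nx nx] [Ny ny]; apply: finj; apply/eqP; rewrite eqn_leq.
  apply/andP; split; rewrite leqNgt; apply/negP => h.
    by apply: nx; exists y.
  by apply: ny; exists x.
- move=> x xN; split; first exact: (cN x).2.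
  by move=> [y /= yx /xN xy]; move: yx; rewrite xy ltnn.
Qed.

(** In a decreasing sequence of clopen sets, each step drops the point of least index with a clopen
    neighbourhood and keeps another point. Every point is dropped eventually, and the successive
    differences are the pieces. *)
Lemma crowded_clopen_partition (X : topologicalType) :
  hausdorff_space X -> crowded_space X -> countable [set: X] ->
  (forall (x : X) W, nbhs x W -> exists V, [/\ clopen V, V x & V `<=` W]) ->
  exists Y : nat -> set X,
  [/\ forall n, clopen (Y n), forall n, Y n !=set0, forall z, exists n, Y n z &
      forall m n z, Y m z -> Y n z -> m = n].
Proof.
move=> hX [X0 iX] /countable_injP[f finj] zX.
have {}finj x y : f x = f y -> x = y by apply: finj; exact: in_setT.
have step (H : set X) : exists H', clopen H -> H !=set0 ->
    [/\ clopen H', H' !=set0, H' `<=` H, H `\` H' !=set0 &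
     exists x, [/\ H x, ~ H' x & forall y, H y -> (f x <= f y)%N]].
  have [[cH [h Hh]]|nH] := pselect (clopen H /\ H !=set0); last first.
    by exists H => cH H0; case: nH.
  have ex : exists n, `[< exists2 x, f x = n & H x >].
    by exists (f h); apply/asboolP; exists h.
  case: (ex_minnP ex) => _ /asboolP[x <- Hx] xP.
  have [y Hy yx] : exists2 y, H y & y <> x.
    apply: contrapT => nH; suff : isolated [set: X] x by rewrite iX.
    split; first exact: in_setT.
    exists H; first by apply: open_nbhs_nbhs; split => //; exact: cH.1.
    rewrite setIT; apply/seteqP; split => [z Hz|_ -> //].
    by apply: contrapT => zx; apply: nH; exists z.
  have [|V [cV Vx VW]] := zX x (H `&` ~` [set y]).
    apply: open_nbhs_nbhs; split; last by split => // xy; exact: yx.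
    apply: openI; first exact: cH.1.
    apply: closed_openC; apply: accessible_closed_set1.
    exact: hausdorff_accessible.
  exists (H `\` V) => _ _; split.
  - by rewrite setDE; apply: clopenI => //; apply: (@clopenC _ _ set0).
  - by exists y; split => // /VW[_]; exact.
  - by move=> z [].
  - by exists x; split => // -[_]; exact.
  - exists x; split => [//|[_]|z Hz]; first exact.
    by apply: xP; apply/asboolP; exists z.
have /choice[nxt nxtP] := step.
pose H n := iter n nxt setT.
have cH n : clopen (H n) /\ H n !=set0.
  elim: n => [|n [cH H0]]; first by split => //; exact: clopenT.
  by have [] := nxtP _ cH H0.
have HS n := nxtP _ (cH n).1 (cH n).2.
have Hf n z : H n z -> (n <= f z)%N.
  elim: n z => // n IH z HSz; have [_ _ HSH _ [x [Hx nx xP]]] := HS n.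
  have Hz := HSH _ HSz; rewrite ltn_neqAle (IH _ Hz) andbT; apply/eqP => nz.
  apply: nx; rewrite (finj x z) //; apply/eqP.
  by rewrite eqn_leq xP //= -nz IH.
have Hdec m n : (m <= n)%N -> H n `<=` H m.
  elim: n => [|n IH]; first by rewrite leqn0 => /eqP ->.
  rewrite leq_eqVlt => /orP[/eqP -> //|/IH mn]; have [_ _ HSH _ _] := HS n.
  exact: subset_trans mn.
exists (fun n => H n `\` H n.+1); split.
- move=> n; rewrite setDE; apply: clopenI; first exact: (cH n).1.
  by apply: (@clopenC _ _ set0); exact: (cH n.+1).1.
- by move=> n; have [] := HS n.
- move=> z; have ex : exists n, `[< ~ H n z >].
    by exists (f z).+1; apply/asboolP => /Hf; rewrite ltnn.
  case: (ex_minnP ex) => -[|n] /asboolP nH mP; first by case: nH.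
  exists n; split => //; apply: contrapT => nHn.
  by have := mP n (introT (asboolP _) nHn); rewrite ltnn.
- move=> m n z [Hm nHm] [Hn nHn]; apply/eqP; rewrite eqn_leq.
  apply/andP; split; rewrite leqNgt; apply/negP => h.
    exact: nHn (Hdec _ _ h _ Hm).
  exact: nHm (Hdec _ _ h _ Hn).
Qed.

(* [B d] will be a local base no larger than any local pi-base at [d], so that
   near [d] a thin family is too small to be a local pi-base at [d]. *)
Definition thin (X : topologicalType) (B : X -> set (set X)) (D : set X)
    (GG : set (set X)) : Prop :=
  forall d, D d -> exists2 U, nbhs d U &
    ~ (B d #<= [set G | GG G /\ G `&` U !=set0]).

Definition good_level (X L : Type) (A : L -> set (set X)) (O G : set X)
    (a : L) : Prop :=
  exists C, [/\ A a C, G `&` C !=set0 & C `&` O = set0].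

(** Asking that [a] be below every good level of [G] bounds it by the rank of [G] without choosing
    that rank. *)
Definition refine (X L : Type) (le : L -> L -> Prop) (A : L -> set (set X))
    (O : set X) (GG : set (set X)) : set (set X) :=
  [set H | H !=set0 /\ exists G C a, [/\ GG G, A a C, H = G `&` C &
    forall b, good_level A O G b -> le a b]].

Section FarPoint.
Variables (X : topologicalType) (B : X -> set (set X)).
Variables (L : Type) (le : L -> L -> Prop) (A : L -> set (set X)).
Hypothesis Binf : forall d, infinite_set (B d).
Hypothesis X_countable : countable [set: X].
Hypothesis X_zero_dim :
  forall (x : X) W, nbhs x W -> exists V, [/\ clopen V, V x & V `<=` W].
Hypothesis le_least : has_least le.
Hypothesis A_mono : forall a b, le a b -> A a `<=` A b.
Hypothesis A_clopen : forall a, A a `<=` clopen.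
Hypothesis A_level : forall d W (G : set (set X)), nbhs d W -> G `<=` open ->
  ~ (B d #<= G) -> exists U O a,
    [/\ [/\ clopen U, clopen O, O d, O `<=` U & U `<=` W],
        A a (U `\` O), ~ (B d #<= A a) &
        forall g, G g -> g `&` U !=set0 -> g `&` (U `\` O) !=set0].

(** Each [d] in [D] gets a piece [Q d] of a clopen partition and, in it, [O d] inside [U d] such
    that [U d \ O d] meets every member of [GG] that meets [U d]. The level of this difference
    bounds the ranks near [d]. *)
Lemma exists_refinement (D : set X) (GG : set (set X)) :
  closed D -> discrete_subset D -> GG `<=` open -> thin B D GG ->
  (forall G, GG G -> G !=set0) ->
  exists O, [/\ clopen O, D `<=` O, forall G, GG G -> exists a, good_level A O G a &
    thin B D (refine le A O GG)].
Proof.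
move=> clD discD GGo GGthin GGn0.
have /choice[N NP] (x : X) : exists N, [/\ clopen N, N x, N `&` D `<=` [set x] &
    D x -> ~ (B x #<= [set G | GG G /\ G `&` N !=set0])].
  have [Dx|nDx] := pselect (D x); last first.
    have [|V [cV Vx VD]] := X_zero_dim (x := x) (W := ~` D).
      by apply: open_nbhs_nbhs; split => //; exact: closed_openC.
    by exists V; split => // z [/VD].
  have [U xU GU] := GGthin _ Dx; have [_ [V xV VD]] := discD _ Dx.
  have [|V' [cV' V'x V'UV]] := X_zero_dim (x := x) (W := U `&` V).
    exact: filterI.
  exists V'; split => //; first by move=> z [/V'UV[_ Vz] Dz]; rewrite -VD.
  move=> _; apply: contra_not GU => /card_le_trans; apply; apply: subset_card_le.
  by move=> G [GGG [z [Gz /V'UV[Uz _]]]]; split => //; exists z.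
have [|Q [QP Qcov Qdisj Qx]] := clopen_partition_shrink (N := N) X_countable.
  by move=> x; have [] := NP x.
have cQ x : clopen (Q x) := (QP x).1.
have QN x : Q x `<=` N x := (QP x).2.
have DQ d : D d -> Q d d.
  by move=> Dd; apply: Qx => y Ny; have [_ _ /(_ d (conj Ny Dd))] := NP y.
(* Outside [D] the default is an empty [O d], with [None] as its level. *)
have /choice[UOa UOaP] (d : X) : exists p : set X * set X * option L,
    clopen p.1.2 /\ (p.1.2 `<=` Q d) /\ ((~ D d -> p.1.2 = set0) /\
    (D d -> [/\ clopen p.1.1, p.1.2 d, p.1.2 `<=` p.1.1, p.1.1 `<=` Q d &
    exists a, [/\ p.2 = Some a, A a (p.1.1 `\` p.1.2), ~ (B d #<= A a) &
      forall g, GG g -> g `&` p.1.1 !=set0 -> g `&` (p.1.1 `\` p.1.2) !=set0]])).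
  have [Dd|nDd] := pselect (D d); last first.
    exists (set0, set0, None); split; first exact: clopen0.
    by split => //; split.
  have [_ _ _ /(_ Dd) GN] := NP d.
  have [||U [ O [a [[cU cO Od OU UQ] AUO BA GUO]]]] :=
      A_level (W := Q d) (G := [set G | GG G /\ G `&` N d !=set0]) _ _ GN.
  - by apply: open_nbhs_nbhs; split; [exact: (cQ d).1|exact: DQ].
  - by move=> G [/GGo].
  exists (U, O, Some a); split => //; split; first exact: subset_trans UQ.
  split => // _; split => //=; exists a; split => // g GGg [z [gz Uz]].
  by apply: GUO; [split => //|]; exists z; split => //; apply: QN; exact: UQ.
pose U d := (UOa d).1.1; pose O d := (UOa d).1.2.
have OQ d : O d `<=` Q d by have [_ []] := UOaP d.
have D_U d : D d -> [/\ clopen (U d), O d d, O d `<=` U d, U d `<=` Q d &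
    exists a, [/\ A a (U d `\` O d), ~ (B d #<= A a) &
      forall g, GG g -> g `&` U d !=set0 -> g `&` (U d `\` O d) !=set0]].
  move=> Dd; have [_ [_ [_ /(_ Dd)[? ? ? ? [a [_ ? ? ?]]]]]] := UOaP d.
  by split => //; exists a.
have OD d z : O d z -> D d.
  move=> Oz; apply: contrapT => nD; have [_ [_ [/(_ nD) eO _]]] := UOaP d.
  by move: Oz; rewrite /O eO.
have UO0 d : D d -> (U d `\` O d) `&` \bigcup_e O e = set0.
  move=> Dd; have [_ _ _ UQ _] := D_U _ Dd.
  apply/seteqP; split => // z [[Uz nOz] [e _ Oez]]; apply: nOz.
  by rewrite (Qdisj d e z) //; [exact: UQ|exact: OQ].
have cO : clopen (\bigcup_e O e).
  apply: (clopen_bigcup_partition cQ) => // d; by have [] := UOaP d.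
exists (\bigcup_e O e); split => //.
- by move=> d Dd; exists d => //; have [] := D_U _ Dd.
- move=> G GGG.
  have [[d [Dd GU]]|nG] := pselect (exists d, D d /\ G `&` U d !=set0).
    have [_ _ _ _ [a [AUO _ GUO]]] := D_U _ Dd.
    by exists a, (U d `\` O d); split => //; [exact: GUO|exact: UO0].
  have [z Gz] := GGn0 _ GGG.
  have nOz : ~ (\bigcup_e O e) z.
    move=> [d _ Odz]; apply: nG; exists d; split; first exact: OD Odz.
    by exists z; split => //; have [_ _ OU _ _] := D_U _ (OD _ _ Odz); exact: OU.
  (* The point [z] of [G] lies outside the union, so the family [[set G]] yields a good level inside
     the complement of that union. *)
  have [|||V [ O' [a [[_ _ O'z O'V VW] AVO _ GVO]]]] :=
      A_level (d := z) (W := ~` \bigcup_e O e) (G := [set G]).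
  - by apply: open_nbhs_nbhs; split => //; apply: closed_openC; exact: cO.2.
  - by move=> _ ->; exact: GGo.
  - by move=> /card_le_finite/(_ (finite_set1 G)); exact: Binf.
  exists a, (V `\` O'); split => //.
    by apply: GVO => //; exists z; split => //; exact: O'V.
  by apply/seteqP; split => // w [[/VW nOw _] /nOw].
- move=> d Dd; have [cU Od OU UQ [a [AUO BA GUO]]] := D_U _ Dd.
  exists (U d).
    by apply: open_nbhs_nbhs; split; [exact: cU.1|exact: OU].
  have [_ _ _ /(_ Dd) GN] := NP d.
  (* A refined set near [d] comes from a pair [(G, C)] with [G] near [d] and [C] in [A a], as [a] is
     a good level of [G]. Both ranges are smaller than [B d]. *)
  apply: contra_not (card_ltX (Binf (d := d)) GN BA) => /card_le_trans; apply.
  apply: card_le_trans (card_image_le (fun p => p.1 `&` p.2) _).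
  apply: subset_card_le => H [[_ [G [C [b [GGG Ab -> bP]]]]] [z [[Gz Cz] Uz]]].
  exists (G, C) => //; split => /=.
    by split => //; exists z; split => //; apply: QN; exact: UQ.
  apply: A_mono Ab; apply: bP; exists (U d `\` O d); split => //.
    by apply: GUO => //; exists z.
  exact: UO0.
Qed.

(** The family [[set Y]] is thin since [B d] is infinite. Choosing the neighbourhood as a function
    of the family turns the construction into plain iteration. *)
Lemma exists_refinements (D Y : set X) :
  closed D -> discrete_subset D -> open Y -> Y !=set0 ->
  exists (O : nat -> set X) (GG : nat -> set (set X)),
  [/\ GG 0 = [set Y], forall i, GG i.+1 = refine le A (O i) (GG i),
     forall i, clopen (O i) /\ D `<=` O i &
     forall i G, GG i G -> G !=set0 /\ exists a, good_level A (O i) G a].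
Proof.
move=> clD discD oY Y0.
pose inv GG := [/\ GG `<=` open, thin B D GG & forall G, GG G -> G !=set0].
have /choice[nbh nbhP] GG : exists O, inv GG -> [/\ clopen O, D `<=` O,
    forall G, GG G -> exists a, good_level A O G a & inv (refine le A O GG)].
  have [[GGo GGthin GGn0]|ninv] := pselect (inv GG); last by exists set0.
  have [N [cO DO GGO thinO]] := exists_refinement clD discD GGo GGthin GGn0.
  exists N => _; split => //; split => // [H|H [//]].
  move=> [_ [G [C [a [GGG AC -> _]]]]]; apply: openI; first exact: GGo.
  exact: (A_clopen AC).1.
pose GG i := iter i (fun GG => refine le A (nbh GG) GG) [set Y].
have GGinv i : inv (GG i).
  elim: i => [|i IH]; last by have [] := nbhP _ IH.
  split; [by move=> _ ->| |by move=> _ ->] => d Dd.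
  exists setT; first exact: filterT.
  move=> /card_le_finite BY; apply: (Binf (d := d)); apply: BY.
  by apply: sub_finite_set (finite_set1 Y) => G [].
exists (fun i => nbh (GG i)), GG; split => // i; first by have [] := nbhP _ (GGinv i).
move=> G GGG; have [_ _ /(_ _ GGG)] := nbhP _ (GGinv i).
by have [_ _ /(_ _ GGG)] := GGinv i.
Qed.

(* The member of [s] whose good level for [C] is least cuts [C] down to a set
   that belongs to the refinements of all the others. *)
Lemma refinements_linked (I : eqType) (O : I -> nat -> set X)
    (GG : I -> nat -> set (set X)) :
  (forall D i, GG D i.+1 = refine le A (O D i) (GG D i)) ->
  (forall D i G, GG D i G -> exists a, good_level A (O D i) G a) ->
  forall n (s : seq I) i C, size s = n -> C !=set0 ->
  (forall D, D \in s -> GG D i C) ->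
  exists2 z, C z & forall D, D \in s -> exists2 j, (j < i + n)%N & ~ O D j z.
Proof.
move=> GGS GGgood; elim=> [|n IH] s i C.
  by move=> /size0nil -> [z Cz] _; exists z.
move=> sn [z0 Cz0] sC.
have [|a [D Ds aD] aP] :=
    le_least (P := [set a | exists2 D, D \in s & good_level A (O D i) C a]).
  case: s sn sC => // D s _ sC; have Ds : D \in D :: s by rewrite inE eqxx.
  by have [a aD] := GGgood _ _ _ (sC _ Ds); exists a, D.
have [C' [AC' CC' C'O]] := aD.
have [|E Es|z [Cz C'z] zP] := IH (rem D s) i.+1 (C `&` C') _ CC'.
- by rewrite size_rem // sn.
- have Es' := mem_rem Es; rewrite GGS; split => //.
  exists C, C', a; split => //; first exact: sC.
  by move=> b bE; apply: aP; exists E.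
exists z => // E Es; have [->|ED] := eqVneq E D.
  exists i; first by rewrite addnS ltnS leq_addr.
  by move=> Oz; have : (C' `&` O D i) z by []; rewrite C'O.
have [|j ji nOz] := zP E; last by exists j => //; rewrite addnS -addSn.
have := perm_to_rem Ds => /perm_mem/(_ E).
by rewrite Es inE (negPf ED) => /esym.
Qed.

End FarPoint.

(** * The far point *)

(** Avoiding finitely many sets [W D] at one point gives the finite intersection property used in
    beta X; [n] of them are avoided inside the piece [Y n]. *)
Lemma clopen_nbhds_not_covering (X : topologicalType) :
  hausdorff_space X -> crowded_space X -> countable [set: X] ->
  (forall (x : X) W, nbhs x W -> exists V, [/\ clopen V, V x & V `<=` W]) ->
  (forall x : X, character_eq_pi_character x) ->
  exists W : set X -> set X,
    (forall D, closed D -> discrete_subset D -> clopen (W D) /\ D `<=` W D) /\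
    forall s : seq (set X), exists z, forall D, D \in s -> ~ W D z.
Proof.
move=> hX crX cX zX chX; have iX := crX.2.
have /choice[B BP] (d : X) : exists B, local_base d B /\
    forall C, local_pi_base d C -> B #<= C.
  have [B [C [[Bb _] [_ CP] BC]]] := chX d; exists B; split => // C' /CP.
  by rewrite (card_le_eql BC).
have [L [le [A [lel Amono Acl Alev]]]] :=
  exists_levels hX iX cX zX (fun d => (BP d).1) (fun d => (BP d).2).
have Binf d : infinite_set (B d) := local_base_infinite hX iX (BP d).1.
have [Y [cY Y0 Ycov Ydisj]] := crowded_clopen_partition hX crX cX zX.
have dis0 : discrete_subset (set0 : set X) by [].
(* A set that is not closed and discrete gets the families built for [set0], so that the refinement
   clauses hold for every [D]. *)
have /choice[F FP] (p : set X * nat) :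
    exists OG : (nat -> set X) * (nat -> set (set X)),
    [/\ OG.2 0 = [set Y p.2], forall i, OG.2 i.+1 = refine le A (OG.1 i) (OG.2 i),
     forall i, clopen (OG.1 i),
     forall i G, OG.2 i G -> exists a, good_level A (OG.1 i) G a &
     closed p.1 -> discrete_subset p.1 -> forall i, p.1 `<=` OG.1 i].
  have refs D : closed D -> discrete_subset D -> _ := fun clD dD =>
    exists_refinements Binf cX zX Amono Acl Alev clD dD (cY p.2).1 (Y0 p.2).
  have [[clD dD]|nD] := pselect (closed p.1 /\ discrete_subset p.1).
    have [N [GG [GG0 GGS cN GGP]]] := refs _ clD dD; exists (N, GG); split => //.
    - by move=> i; exact: (cN i).1.
    - by move=> i G /GGP[].
    - by move=> _ _ i; exact: (cN i).2.
  have [N [GG [GG0 GGS cN GGP]]] := refs _ closed0 dis0; exists (N, GG); split => //.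
  - by move=> i; exact: (cN i).1.
  - by move=> i G /GGP[].
  - by move=> clD dD; case: nD.
pose W D := \bigcup_n (Y n `&` \bigcap_(i < n) (F (D, n)).1 i).
exists W; split => [D clD dD|s].
  split.
    apply: (clopen_bigcup_partition cY _ _ Ycov Ydisj) => [n|n z []//].
    apply: clopenI; first exact: cY.
    by apply: clopen_bigcap_lt; have [] := FP (D, n).
  move=> z Dz; have [n Yz] := Ycov z; exists n => //; split => // i _.
  by have [_ _ _ _ /(_ clD dD)/(_ i)] := FP (D, n); apply.
pose n := size s.
have [||//|||z Yz zP] := @refinements_linked _ _ le A lel _ (fun D => (F (D, n)).1)
    (fun D => (F (D, n)).2) _ _ n s 0 (Y n).
- by move=> D; have [] := FP (D, n).
- by move=> D; have [] := FP (D, n).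
- exact: Y0.
- by move=> D _; have [-> _ _ _] := FP (D, n).
exists z => D Ds [m _ [Ymz Wz]]; rewrite (Ydisj m n z) // in Wz.
by have [j jn] := zP D Ds; apply; exact: Wz.
Qed.

(** * Passage to beta X *)

(** The finite intersections of the sets [Z i] generate a proper filter, and a cluster point of it
    lies in each closed [Z i]. *)
Lemma closed_finI_compact (T : topologicalType) (I : eqType) (P : set I)
    (Z : I -> set T) :
  compact [set: T] -> (forall i, P i -> closed (Z i)) ->
  (forall s : seq I, (forall i, i \in s -> P i) ->
     exists p, forall i, i \in s -> Z i p) ->
  exists p, forall i, P i -> Z i p.
Proof.
move=> cT clZ fip.
pose F : set_system T := [set A | exists2 s : seq I, (forall i, i \in s -> P i) &
  forall p, (forall i, i \in s -> Z i p) -> A p].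
have FF : ProperFilter F.
  split; last split.
  - by move=> [s /fip[p sp]] /(_ _ sp).
  - by exists [::].
  - move=> A A' [s sP sA] [t tP tA']; exists (s ++ t).
      by move=> i; rewrite mem_cat => /orP[/sP|/tP].
    move=> p stp; split; [apply: sA|apply: tA'] => i ist; apply: stp.
      by rewrite mem_cat ist.
    by rewrite mem_cat ist orbT.
  - by move=> A A' AA' [s sP sA]; exists s => // p /sA/AA'.
have [p [_ clp]] := cT F FF filterT; exists p => i Pi.
rewrite (closure_id (Z i)).1; last exact: clZ.
move=> V pV; apply: clp => //; exists [:: i] => [j|q]; first by rewrite inE => /eqP ->.
by apply; rewrite inE.
Qed.

(** The indicator of a clopen set is locally constant, hence continuous, with values in [0, 1]. *)
Lemma clopen_indicator_extends (R : realType) (X : topologicalType) (W : set X) :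
  clopen W -> exists2 g : stone_cech R X -> R, continuous g &
    forall x, (W x -> g (sc_embed R x) = 1%R) /\
              (~ W x -> g (sc_embed R x) = 0%R).
Proof.
move=> [Wo clW]; pose f := (fun x => if pselect (W x) then 1 else 0 : R)%R.
have f1 x : W x -> f x = 1%R by rewrite /f; case: pselect.
have f0 x : ~ W x -> f x = 0%R by rewrite /f; case: pselect.
have [||g cg gf] := @sc_embed_extend R X f.
- move=> x V fV; have [Wx|nWx] := pselect (W x).
    apply: (filterS (P := W)); last exact: open_nbhs_nbhs.
    by move=> y Wy; rewrite /= (f1 y) // -(f1 x) //; exact: nbhs_singleton.
  apply: (filterS (P := ~` W)); last first.
    by apply: open_nbhs_nbhs; split => //; exact: closed_openC.
  by move=> y Wy; rewrite /= (f0 y) // -(f0 x) //; exact: nbhs_singleton.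
- move=> _ [x _ <-]; have [Wx|Wx] := pselect (W x).
    by rewrite (f1 x Wx) /= in_itv /= lexx ler01.
  by rewrite (f0 x Wx) /= in_itv /= lexx ler01.
by exists g => // x; rewrite gf; split => [/f1|/f0].
Qed.

Theorem theorem4p2 (R : realType) (X : topologicalType)
  (X_tychonoff : tychonoff_space X)
  (X_countable : countable [set: X])
  (X_regular : regular_space X)
  (X_crowded : crowded_space X)
  (X_character : forall x : X, character_eq_pi_character x) :
  exists p : stone_cech R X, far_point p.
Proof.
have [hX crX] := X_tychonoff.
have zX := countable_clopen_base R X_countable crX.
have [W [WP Wfip]] := clopen_nbhds_not_covering hX X_crowded X_countable zX X_character.
pose P : set (set X) := [set D | closed D /\ discrete_subset D].
have /choice[g gP] (D : set X) : exists g : stone_cech R X -> R, continuous g /\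
    (P D -> forall x, (W D x -> g (sc_embed R x) = 1%R) /\
      (~ W D x -> g (sc_embed R x) = 0%R)).
  have [[clD dD]|nP] := pselect (P D); last first.
    by exists (fun=> 0%R); split => [|/nP //]; exact: cst_continuous.
  by have [g cg gW] := clopen_indicator_extends R (WP D clD dD).1; exists g.
(* A point of [X] outside finitely many [W D] is a common zero of their [g D]; compactness gives a
   common zero [p] of all. *)
have [||p pP] := @closed_finI_compact _ _ P (fun D => g D @^-1` [set 0%R])
    (@stone_cech_compact R X).
- move=> D PD; apply: closed_comp; last exact: closed_eq.
  by move=> q _; exact: (gP D).1.
- move=> s sP; have [z zP] := Wfip s; exists (sc_embed R z) => D Ds.
  by have [_ /(_ (sP D Ds))/(_ z)[_]] := gP D; apply; exact: zP.
(* [g D] equals 1 on the image of [D], hence on its closure, but vanishes at [p]. *)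
have far D : P D -> ~ closure (@sc_embed R X @` D) p.
  move=> PD clp; have [cg gW] := gP D.
  have : closure (g D @^-1` [set 1%R]) p.
    apply: closureS clp => _ [x Dx <-]; apply: (gW PD x).1.
    by apply: (WP D PD.1 PD.2).2.
  rewrite -(closure_id _).1; last first.
    by apply: closed_comp; [move=> q _; exact: cg|exact: closed_eq].
  by rewrite /= (pP D PD) => /eqP; rewrite eq_sym oner_eq0.
exists p; split => [[x _ xp]|D clD dD]; last exact: far.
(* Singletons are closed and discrete, so [p] is also outside the image of [X]. *)
have Px : P [set x].
  split; first by apply: accessible_closed_set1; exact: hausdorff_accessible.
  move=> y ->; split; first exact: mem_set.
  by exists setT; [exact: filterT|rewrite setTI].
apply: (far _ Px); rewrite -xp; apply: subset_closure; by exists x.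
Qed.
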